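(* Let $f:2^\omega\to2^\omega$ be a continuous mapping. If $X\subseteq 2^\omega$ is $\mathcal M$-additive, then so is $f(X)$.
   Context: $2^\omega$ is the Cantor cube with its product topology, a compact group under coordinatewise addition mod 2. $\mathcal M$ is the ideal of meager subsets of $2^\omega$. A set $X\subseteq2^\omega$ is $\mathcal M$-additive if $X+M=\{x+m:x\in X,m\in M\}\in\mathcal M$ for every $M\in\mathcal M$. *)

(* Defs.v *)
From mathcomp Require Import all_boot.
From mathcomp Require Import boolp classical_sets functions topology cantor.

Set Implicit Arguments.
Unset Strict Implicit.
Unset Printing Implicit Defensive.

Local Open Scope classical_set_scope.

Definition nowhere_dense (T : topologicalType) (A : set T) : Prop :=
  interior (closure A) = set0.

Definition meager (T : topologicalType) (A : set T) : Prop :=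
  exists2 F : nat -> set T,
    forall n, nowhere_dense (F n) & A = \bigcup_n F n.

(* Coordinatewise addition mod 2: [(+)] is exclusive or on [bool]. *)
Definition cantor_add (x y : cantor_space) : cantor_space :=
  fun n => x n (+) y n.

Definition M_additive (X : set cantor_space) : Prop :=
  forall M : set cantor_space, meager M ->
    meager [set cantor_add x m | x in X & m in M].

(* Main.v *)
(* Meager sets are those contained, for some partition of [nat] into finite
   intervals and some [z], in the set of points differing from [z] on almost all
   intervals.  This yields half of the Bartoszynski-Judah characterization: if
   [X] is M-additive, then for every interval partition [I_k] there are a coarser
   one [J_n] and a point [y] such that each [x] in [X] agrees with [y], for almost
   all [n], on some [I_k] inside [J_n].
   Agreement on a block, rather than on an initial segment, is not visibly
   preserved by a continuous [f].  But [I_k = [F k, F (k+1))] may grow so fast that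
   [x] on [0, F (k+1)) determines [f x] on the next [2 ^ F k] blocks of a partition
   given on the image side.  One such block is devoted to each of the [2 ^ F k]
   possible prefixes of [x] of length [F k], extended by [y]: on the block of the
   right prefix, [f x] takes a prescribed value. *)
Require Import Defs.
From mathcomp Require Import all_boot.
From mathcomp Require Import boolp classical_sets functions topology cantor.
From mathcomp Require Import zify.

Local Open Scope classical_set_scope.

(** * Interval partitions given by increasing sequences, and binary prefixes *)

Lemma increasing_ltn (h : nat -> nat) :
  (forall n, h n < h n.+1) -> {homo h : m n / m < n}.
Proof. by move=> hS; apply: homo_ltn hS => y x z; exact: ltn_trans. Qed.

Lemma increasing_leq (h : nat -> nat) :
  (forall n, h n < h n.+1) -> {homo h : m n / m <= n}.
Proof. by move=> hS; apply: ltnW_homo; exact: increasing_ltn. Qed.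

Lemma increasing_ge_id (h : nat -> nat) :
  (forall n, h n < h n.+1) -> forall n, n <= h n.
Proof. by move=> hS; elim=> // n /leq_ltn_trans; apply. Qed.

Lemma increasing_block_uniq (h : nat -> nat) (m n i : nat) :
  (forall n, h n < h n.+1) ->
  h m <= i < h m.+1 -> h n <= i < h n.+1 -> m = n.
Proof.
move=> hS /andP[mi im] /andP[ni in_]; apply/eqP; rewrite eqn_leq.
apply/andP; split; rewrite leqNgt; apply/negP => /(increasing_leq h hS); lia.
Qed.

Lemma increasing_block_exists (h : nat -> nat) (a b i : nat) :
  h a <= i < h b -> (forall n, h n < h n.+1) ->
  exists2 k, a <= k < b & h k <= i < h k.+1.
Proof.
move=> /andP[ai ib] hS; elim: b ib => [|b IHb] ib.
  by have := increasing_leq h hS 0 a (leq0n a); lia.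
have [/IHb[k kab ki]|bi] := ltnP i (h b); first by exists k => //; lia.
exists b; last by rewrite bi.
rewrite ltnS leqnn andbT leqNgt; apply/negP => /(increasing_leq h hS); lia.
Qed.

Lemma glue_blocks (T : Type) (h : nat -> nat) (t : nat -> nat -> T) :
  (forall n, h n < h n.+1) ->
  exists z, forall n i, h n <= i < h n.+1 -> z i = t n i.
Proof.
move=> hS; suff /choice[z hz] : forall i, exists v,
    forall n, h n <= i < h n.+1 -> v = t n i by exists z => n i; exact: hz.
move=> i; have [[n hn]|nex] := pselect (exists n, h n <= i < h n.+1).
  by exists (t n i) => m /(increasing_block_uniq h _ _ _ hS hn) ->.
by exists (t 0 i) => n hn; case: nex; exists n.
Qed.

(* [N]-bit prefixes are the binary expansions of the numbers below [2 ^ N]. *)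
Lemma binary_prefix (N : nat) (x : nat -> bool) :
  exists2 j, j < 2 ^ N & forall i, i < N -> odd (j %/ 2 ^ i) = x i.
Proof.
elim: N x => [|N IHN] x; first by exists 0.
have [j jN jx] := IHN (x \o S); exists (x 0 + j.*2).
  by rewrite expnS mul2n; case: (x 0); lia.
case=> [|i] iN; first by rewrite divn1 oddD odd_double addbF oddb.
by rewrite expnS divnMA divn2 half_bit_double; exact: jx.
Qed.

(** * Cylinders and uniform continuity on the Cantor space *)

Definition agree {T : Type} (L : nat) (x y : nat -> T) : Prop :=
  forall i, i < L -> x i = y i.

Definition splice {T : Type} (L : nat) (x y : nat -> T) : nat -> T :=
  fun i => if i < L then x i else y i.

Lemma nbhs_cylinder (x : cantor_space) (L : nat) :
  nbhs x [set y : cantor_space | agree L x y].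
Proof.
elim: L => [|L IHL]; first by apply: filterS filterT => y _ i.
have coordL : nbhs x [set y : cantor_space | y L = x L].
  have := @proj_continuous nat (fun=> bool) L x [set b | b = x L].
  by apply; apply: discrete_set1.
apply: filterS (filterI IHL coordL) => y /= [xy yL] i.
by rewrite ltnS leq_eqVlt => /predU1P[->//|]; exact: xy.
Qed.

(** Each point outside the interior of [A] differs from [x] at some coordinate, and so do its
    neighbours; compactness bounds these coordinates by one [L]. *)
Lemma cylinder_nbhs (x : cantor_space) (A : set cantor_space) :
  nbhs x A -> exists L, [set y : cantor_space | agree L x y] `<=` A.
Proof.
move=> xA; have cK : compact (~` A°).
  apply: (subclosed_compact _ cantor_space_compact) => //.
  by apply: open_closedC; exact: open_interior.
have /compact_near_coveringP/(_ _ \oo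
    (fun L (y : cantor_space) => ~ agree L x y)) := cK.
case.
- move=> y Ky; have [i xyi] : exists i, x i <> y i.
    by apply: contrapT => /forallNP xy; apply: Ky;
      suff <- : x = y by []; apply/funext => i; apply: contrapT; exact: xy.
  exists ([set y' : cantor_space | agree i.+1 y y'], [set L | i < L]).
    by split; [exact: nbhs_cylinder | exists i.+1].
  by move=> [y' L] /= [yy' iL] /(_ i iL); rewrite -yy'.
move=> L _ /(_ L) /= H; exists L => y xy.
by apply: interior_subset; apply: contrapT => /(H (leqnn L)).
Qed.

Lemma continuous_cantor_modulus (f : cantor_space -> cantor_space) :
  continuous f -> forall N, exists L, forall x y,
    agree L x y -> agree N (f x) (f y).
Proof.
move=> cf N; have /compact_near_coveringP/(_ _ \oo
    (fun L (x : cantor_space) => forall y,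
       agree L x y -> agree N (f x) (f y))) := cantor_space_compact.
case.
- move=> x _; have [L fL] := cylinder_nbhs _ _ (cf x _ (nbhs_cylinder (f x) N)).
  exists ([set y : cantor_space | agree L x y], [set L' | L <= L']).
    by split; [exact: nbhs_cylinder | exists L].
  move=> [x' L'] /= [xx' LL'] y x'y i iN.
  rewrite -(fL _ xx' i iN); apply: (fL y) => // j jL.
  by rewrite xx' // x'y //; exact: leq_trans LL'.
by move=> L _ /(_ L) /= H; exists L => x y; exact: H.
Qed.

(** * Meager sets described by blocks *)

Definition block_avoidable (A : set cantor_space) : Prop :=
  forall l, exists L (t : cantor_space), l < L /\
    forall x, A x -> exists2 i, l <= i < L & x i <> t i.

Lemma nowhere_dense_avoid (A : set cantor_space) (w : cantor_space) (L : nat) :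
  nowhere_dense A -> exists (v : cantor_space) K,
    agree L w v /\ forall x, A x -> ~ agree K v x.
Proof.
move=> ndA; apply: contrapT => H.
suff : (closure A)° w by rewrite ndA.
apply: filterS (nbhs_cylinder w L) => v wv B /cylinder_nbhs[K KB].
apply: contrapT => AB; apply: H; exists v, K; split=> // x Ax vx.
by apply: AB; exists x; split=> //; exact: KB.
Qed.

(** One pattern [t] must serve all [2 ^ l] prefixes of length [l]. They are treated in turn: the
    prefix numbered [J], followed by the current pattern, is extended to a cylinder missing [A], and
    the longer pattern still serves the earlier prefixes. *)
Lemma nowhere_dense_block_avoidable (A : set cantor_space) :
  nowhere_dense A -> block_avoidable A.
Proof.
move=> ndA l.
suff /(_ (2 ^ l))[L [t [lL tA]]] : forall J, exists L (t : cantor_space),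
    l < L /\ forall x j, A x -> j < J ->
    (forall i, i < l -> odd (j %/ 2 ^ i) = x i) ->
    exists2 i, l <= i < L & x i <> t i.
  exists L, t; split=> // x Ax.
  by have [j jl jx] := binary_prefix l x; exact: tA jx.
elim=> [|J [L [t [lL tA]]]]; first by exists l.+1, xpredT.
have [v [K [tv vA]]] :=
  nowhere_dense_avoid A (splice l (fun i => odd (J %/ 2 ^ i)) t) L ndA.
exists (maxn L K), v; split=> [|x j Ax]; first lia.
rewrite ltnS leq_eqVlt => /predU1P[->{j}|jJ] jx; last first.
  have [i iL xt] := tA x j Ax jJ jx; exists i; first lia.
  rewrite -tv; last lia.
  by rewrite /splice ltnNge; have /andP[-> _] := iL.
apply: contrapT => H; apply: (vA x Ax) => i iK.
have [il|li] := ltnP i l.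
  by rewrite -tv /splice ?il ?jx //; lia.
by apply: contrapT => vx; apply: H; exists i; [lia|exact: nesym].
Qed.

Lemma block_avoidableU (A B : set cantor_space) :
  block_avoidable A -> block_avoidable B -> block_avoidable (A `|` B).
Proof.
move=> hA hB l; have [L [t [lL tA]]] := hA l; have [K [s [LK sB]]] := hB L.
exists K, (splice L t s); split=> [|x []]; first lia.
- move=> /tA[i iL xt]; exists i; first lia.
  by rewrite /splice; have /andP[_ ->] := iL.
- move=> /sB[i iL xt]; exists i; first lia.
  by rewrite /splice ltnNge; have /andP[-> _] := iL.
Qed.

Lemma meager_blocks (M : set cantor_space) : meager M ->
  exists (h : nat -> nat) (z : cantor_space), (forall n, h n < h n.+1) /\
    forall m, M m -> exists N, forall n, N <= n ->
      exists2 i, h n <= i < h n.+1 & m i <> z i.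
Proof.
(* The sets [C n] increase, so a point of [F N] lies in [C n] for all [n >= N]; it suffices that
   block [n] avoids [C n]. *)
move=> [F ndF ->]; pose C n := [set x | exists2 k, k <= n & F k x].
have avC n : block_avoidable (C n).
  elim: n => [|n IHn].
    suff -> : C 0 = F 0 by apply: nowhere_dense_block_avoidable.
    apply/seteqP; split=> x; last by exists 0.
    by case=> k; rewrite leqn0 => /eqP ->.
  suff -> : C n.+1 = C n `|` F n.+1.
    apply: block_avoidableU IHn _; exact: nowhere_dense_block_avoidable.
  apply/seteqP; split=> x.
    case=> k; rewrite leq_eqVlt => /predU1P[->|]; first by right.
    by rewrite ltnS => kn Fx; left; exists k.
  case=> [[k kn Fx]|Fx]; last by exists n.+1.
  by exists k => //; exact: leqW.
have /choice[S hS] : forall p : nat * nat, exists q : nat * cantor_space,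
    p.2 < q.1 /\ forall x, C p.1 x -> exists2 i, p.2 <= i < q.1 & x i <> q.2 i.
  by move=> [n l]; have [L [t ?]] := avC n l; exists (L, t).
pose h := fix h n := if n is m.+1 then (S (m, h m)).1 else 0.
have h_lt n : h n < h n.+1 by have [] := hS (n, h n).
have [z hz] := glue_blocks bool h (fun n => (S (n, h n)).2) h_lt.
exists h, z; split=> // m [N _ Fm]; exists N => n Nn.
have [_ hSn] := hS (n, h n).
have [|i ih mi] := hSn m; first by exists N.
by exists i => //; rewrite (hz n).
Qed.

Lemma blocks_meager (h : nat -> nat) (z : cantor_space) (W : set cantor_space) :
  (forall n, h n < h n.+1) ->
  (forall w, W w -> exists N, forall n, N <= n ->
    exists2 i, h n <= i < h n.+1 & w i <> z i) ->
  meager W.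
Proof.
move=> hS hW; exists (fun N => W `&` [set w | forall n, N <= n ->
    exists2 i, h n <= i < h n.+1 & w i <> z i]); last first.
  apply/seteqP; split=> w; last by case=> N _ [].
  by move=> Ww; have [N hN] := hW w Ww; exists N.
move=> N; apply/seteqP; split=> // p /cylinder_nbhs[L Lcl].
have := increasing_ge_id h hS (maxn N L); set n := maxn N L => nh.
(* As [L <= h n], [q] stays in the cylinder around [p]; but points close to [q] copy [z] on the
   whole block [n]. *)
pose q : cantor_space := splice (h n) p z.
have /(_ _ (nbhs_cylinder q (h n.+1)))[w [[_ hw] qw]] :
    closure (W `&` [set w | forall n, N <= n ->
      exists2 i, h n <= i < h n.+1 & w i <> z i]) q.
  by apply: Lcl => i iL; rewrite /q /splice ifT //; lia.
have [|i /andP[ni in_]] := hw n; first lia.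
by rewrite -qw // /q /splice ltnNge ni.
Qed.

(** * Additive sets and their continuous images *)

Lemma M_additive_blocks (X : set cantor_space) (F : nat -> nat) :
  M_additive X -> (forall k, F k < F k.+1) ->
  exists (g : nat -> nat) (y : cantor_space), (forall n, g n < g n.+1) /\
    forall x, X x -> exists N, forall n, N <= n ->
      exists2 k, g n <= k < g n.+1 &
        forall i, F k <= i < F k.+1 -> x i = y i.
Proof.
move=> hX FS.
pose M := [set m : cantor_space | exists N, forall k, N <= k ->
  exists2 i, F k <= i < F k.+1 & m i <> false].
have /hX/meager_blocks[h [z [hS hz]]] : meager M.
  by apply: (blocks_meager F xpred0).
(* Chosen so that the block of [h] with index [F (g n)] lies within [[F (g n), F (g n.+1))]. *)
pose g := fix g n := if n is m.+1 then h (F (g m)).+1 else 0.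
have F_ge := increasing_ge_id F FS; have h_ge := increasing_ge_id h hS.
have gS n : g n < g n.+1 by apply: leq_trans (h_ge _); rewrite ltnS.
exists g, z; split=> // x Xx; apply: contrapT => /forallNP bad.
pose differ k := exists2 i, F k <= i < F k.+1 & x i <> z i.
(* [m] makes [x + m] equal [z] on every block where [x] and [z] differ. *)
have [m hm] := glue_blocks bool F
  (fun k i => if pselect (differ k) then x i (+) z i else true) FS.
have Mm : M m.
  exists 0 => k _; have [dk|ndk] := pselect (differ k).
    have [i ik xz] := dk; exists i => //; rewrite (hm k) //.
    by case: pselect => // dk'; move: (x i) (z i) xz => [] [].
  exists (F k); first by rewrite leqnn FS.
  by rewrite (hm k) ?leqnn ?FS //; case: pselect.
have [N hN] := hz (cantor_add x m) (ex_intro2 _ _ x Xx (ex_intro2 _ _ m Mm erefl)).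
have /existsNP[n /not_implyP[Nn nk]] := bad N.
(* If [x] differs from [z] on every block [k] with [g n <= k < g n.+1], then [x + m] equals [z] on
   all of them, against the coordinate [i] found here. *)
have [|i /andP[hi ih]] := hN (F (g n)).
  by apply: leq_trans Nn _; apply: leq_trans (F_ge _); exact: increasing_ge_id.
have [|k kn ik] := increasing_block_exists F (g n) (g n.+1) i _ FS.
  by rewrite (leq_trans (h_ge _) hi) (leq_trans ih (F_ge _)).
have dk : differ k.
  apply: contrapT => ndk; apply: nk; exists k => // j jk.
  by apply: contrapT => xz; apply: ndk; exists j.
by rewrite /cantor_add (hm k) //; case: pselect => // dk'; rewrite addKb.
Qed.

Theorem corollary8p9 (f : cantor_space -> cantor_space) (hf : continuous f)
    (X : set cantor_space) (hX : M_additive X) :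
  M_additive (f @` X).
Proof.
move=> M /meager_blocks[h [z [hS hz]]].
have /choice[phi hphi] := continuous_cantor_modulus f hf.
(* Stage [k] owns the [2 ^ F k] blocks of [h] with indices from [a k] to [a k.+1], the last
   excluded; [F k.+1] is large enough for [x] below it to determine [f x] on all of them. *)
pose aF := fix aF k := if k is l.+1 then
    let a := (aF l).1 + 2 ^ (aF l).2 in (a, maxn (aF l).2.+1 (phi (h a)))
  else (0, 0).
pose a k := (aF k).1; pose F k := (aF k).2.
have aS k : a k.+1 = a k + 2 ^ F k by [].
have F_phi k : phi (h (a k.+1)) <= F k.+1 by exact: leq_maxr.
have FS k : F k < F k.+1 by exact: leq_maxl.
have a_lt k : a k < a k.+1 by rewrite aS -addn1 leq_add2l expn_gt0.
have [g [y [gS hy]]] := M_additive_blocks X F hX FS.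
(* Block [i = a k + j] is devoted to the prefix numbered [j]. *)
pose p k i : cantor_space := splice (F k)
  (fun b => odd ((i - a k) %/ 2 ^ b)) y.
have [q hq] := glue_blocks cantor_space a (fun k i => f (p k i)) a_lt.
have [y' hy'] := glue_blocks bool h q hS.
have ag_lt n : a (g n) < a (g n.+1) by apply: increasing_ltn a_lt _ _ (gS n).
(* On a block where [f x] equals [y'], a coordinate with [m] different from [z] makes [f x + m]
   differ from [y' + z]. *)
apply: (blocks_meager (fun n => h (a (g n))) (cantor_add y' z)).
  by move=> n; apply: increasing_ltn hS _ _ (ag_lt n).
move=> _ [_ [x Xx <-] [m Mm <-]].
have [N1 hN1] := hy x Xx; have [N2 hN2] := hz m Mm.
exists (maxn N1 N2) => n nN.
have [|k /andP[gk kg] xy] := hN1 n; first lia.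
(* For the number [j] of the true prefix, [p k (a k + j)] agrees with [x] below [F k], and then up
   to [F k.+1] because [x] agrees with [y] there. *)
have [j jF jx] := binary_prefix (F k) x.
pose i := a k + j.
have ik : a k <= i < a k.+1 by rewrite aS; lia.
have agi : a (g n) <= i.
  by have := increasing_leq a a_lt _ _ gk; lia.
have iag : i.+1 <= a (g n.+1).
  by have := increasing_leq a a_lt _ _ kg; lia.
have fx : agree (h i.+1) (f x) (q i).
  rewrite (hq k) // => b bh; apply: (hphi (h (a k.+1))); last first.
    by apply: leq_trans bh _; apply: increasing_leq hS _ _ _; lia.
  move=> c cphi; have cF := leq_trans cphi (F_phi k).
  rewrite /p /splice /i; have [cFk|Fkc] := ltnP c (F k).
    by rewrite addKn jx.
  by apply: xy; rewrite Fkc.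
have [|b bi mz] := hN2 i.
  have := increasing_ge_id (a \o g) ag_lt n => /=; lia.
exists b.
  have := increasing_leq h hS _ _ agi; have := increasing_leq h hS _ _ iag; lia.
rewrite /cantor_add fx; last by case/andP: bi.
by rewrite (hy' i) // => /addbI.
Qed.
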